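(* Let $f_{(\mu_1,\mu_2)}$, $(\mu_1,\mu_2)\in[0,\varepsilon]^2$ ($\varepsilon>0$ fixed and small), be a family in $\mathfrak{X}^4_\Gamma(\mathbb V)$. For $r\in[0,\varepsilon]$ let $B_r=\{(\mu_1,\mu_2)\in[0,\varepsilon]\times[0,\varepsilon]:\mu_1^2+\mu_2^2\le r^2\}$. Then $$\lim_{r\to0}\frac{\mathrm{Leb}_2\big(\{(\mu_1,\mu_2)\in[0,r]\times[0,r]:\ \mathcal F_{(\mu_1,\mu_2)}\text{ exhibits heteroclinic tangles}\}\cap B_r\big)}{\mathrm{Leb}_2(B_r)}=1,$$ where $\mathrm{Leb}_2$ is two-dimensional Lebesgue measure.
   Context: **The family $\mathfrak X^4_\Gamma(\mathbb V)$.** Let $\mathcal V\subset\mathbb R^2$ be open, $g_1,g_2:\mathcal V\to\mathbb R$ analytic, and let the planar system $\dot x=g_1(x,y),\ \dot y=g_2(x,y)$ have two hyperbolic equilibria $O_1,O_2\in\mathcal V$; the eigenvalues of the linearization at $O_i$ are $-c_i<0<e_i$. Assume: (P1) $c_1>e_1$ and $c_2>e_2$. (P2) For $i=1,2$ there are $d_i,\tilde d_i>0$ with $|mc_i-ne_i|>d_i(|m|+|n|)^{-\tilde d_i}$ for all $m,n\in\mathbb N$. (P3) There are heteroclinic solutions $\ell_1$ from $O_1$ to $O_2$ and $\ell_2$ from $O_2$ to $O_1$ in $\mathcal V$, forming a heteroclinic cycle. It bounds a region $\mathcal A$, and there is a nonempty open $\mathcal V^\star\subset\mathcal A$ all of whose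 solutions have the cycle as $\omega$-limit (inner basin of attraction, absorbing domain). For $\omega>0$ and $\mu_1,\mu_2\in[0,\varepsilon]$ ($\varepsilon>0$ small), with $\theta\in\mathbb S^1=\mathbb R/T\mathbb Z$, the vector field $f_{(\mu_1,\mu_2)}$ on $\mathbb V=\mathcal V\times\mathbb S^1$ is $$\dot x=g_1+\mu_1P_1(x,y,\theta)+\mu_2Q_1(x,y,\theta),\quad \dot y=g_2+\mu_1P_2(x,y,\theta)+\mu_2Q_2(x,y,\theta),\quad \dot\theta=\omega,$$ where $P_j,Q_j$ are $C^4$ and: (P4) $P_j,Q_j$ are $T$-periodic in the last variable. (P5) $P_j,Q_j$ and their first derivatives in $x,y$ vanish at $O_1$ and $O_2$ for all values of the last variable. Let $\mathbf C_i=\{O_i\}\times\mathbb S^1$, a hyperbolic periodic solution, $\mathbb V^\star=\mathcal V^\star\times\mathbb S^1$, and $\Gamma$ the attracting heteroclinic cycle between $\mathbf C_1,\mathbf C_2$ existing for $\mu_1=\mu_2=0$. (P6a) If $\mu_1>0=\mu_2$, then $W^u(\mathbf C_1)\cap W^s(\mathbf C_2)=\emptyset$ (with $W^u(\mathbf C_1)$ entering $\mathbb V^\star$) and $W^u(\mathbf C_2)$, $W^s(\mathbf C_1)$ coincide within $\mathbb V^\star$. (P6b) If $\mu_2>0=\mu_1$, then $W^u(\mathbf C_1)$, $W^s(\mathbf C_2)$ coincide within $\mathbb V^\star$ and $W^u(\mathbf C_2)$ meets $W^s(\mathbf C_1)$ transversely. **Cross sections.** Near $\mathbf C_i$ there are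 $\mu$-dependent coordinates $(x_1^{(i)},x_2^{(i)},\theta^{(i)})$ with $\mathbf C_i=\{x_1^{(i)}=x_2^{(i)}=0\}$, local stable manifold in $\{x_2^{(i)}=0\}$, local unstable manifold in $\{x_1^{(i)}=0\}$. With $\varepsilon_0>0$ small, $\mu=(\mu_1,\mu_2)$ and suitable constants $k_i,k_i'>0$: $\mathrm{In}(\mathbf C_i)=\{x_1^{(i)}=\varepsilon_0,\ -\|\mu\|/k_i\le x_2^{(i)}\le k_i\|\mu\|\}$ (coordinates $(x_2^{(i)},\theta^{(i)})$), $\mathrm{Out}(\mathbf C_1)=\{x_2^{(1)}=\varepsilon_0,\ 0\le x_1^{(1)}\le k_1'\|\mu\|\}$, $\mathrm{Out}(\mathbf C_2)=\{x_2^{(2)}=\varepsilon_0,\ -\|\mu\|/k_2'\le x_1^{(2)}\le k_2'\|\mu\|\}$ (coordinates $(x_1^{(i)},\theta^{(i)})$), $\theta^{(i)}\in\mathbb S^1$. (P7a) The flow induces a $C^3$ embedding $\mathrm{Out}(\mathbf C_1)\to\mathrm{In}(\mathbf C_2)$, $(x,\theta)\mapsto\big(b_1x+\mu_1\Phi_1(x,\theta),\ \theta+\xi_1+\mu_1\Psi_1(x,\theta)\big)$, with $b_1\ne0$, $\xi_1\in\mathbb R$, $\Psi_1$ of class $C^1$, $\Phi_1>0$ of class $C^3$, non-constant, with finitely many critical points, all nondegenerate. (P7b) The flow induces a $C^3$ embedding $\mathrm{Out}(\mathbf C_2)\to\mathrm{In}(\mathbf C_1)$, $(x,\theta)\mapsto\big(b_2x+\mu_2\Phi_2(x,\theta),\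 \theta+\xi_2+\mu_2\Psi_2(x,\theta)\big)$, with $b_2\ne0$, $\xi_2\in\mathbb R$, $\Psi_2,\Phi_2$ of class $C^1$, $\Phi_2$ having at least two nondegenerate zeros. $\mathfrak X^4_\Gamma(\mathbb V)$ denotes the two-parameter families of $C^4$ vector fields $f_{(\mu_1,\mu_2)}$ satisfying (P1)–(P7). **Terminology.** $\mathcal F_{(\mu_1,\mu_2)}$ is the first return map of the flow to $\mathrm{Out}(\mathbf C_1)$ (along $\Gamma$). It exhibits a heteroclinic tangle when, for the flow of $f_{(\mu_1,\mu_2)}$, the manifolds $W^u(\mathbf C_2)$ and $W^s(\mathbf C_1)$ have transverse intersections (transverse heteroclinic connections). *)

(* Defs.v *)
From HB Require Import structures.
From mathcomp Require Import all_boot all_order all_algebra.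
From mathcomp Require Import all_classical all_reals all_analysis.

Set Implicit Arguments.
Unset Strict Implicit.
Unset Printing Implicit Defensive.

Import Order.TTheory GRing.Theory Num.Theory.
Import numFieldNormedType.Exports.

Local Open Scope classical_set_scope.
Local Open Scope ring_scope.

(* The extended phase space V x S^1, S^1 = R / T Z, is handled through its
   universal cover V x R: points are row vectors (x, y, theta) with theta real,
   and everything is T-periodic in theta. *)

Definition vec2 (R : realType) (a b : R) : 'rV[R]_2 :=
  \row_i [:: a; b]`_i.

Definition vec3 (R : realType) (a b c : R) : 'rV[R]_3 :=
  \row_i [:: a; b; c]`_i.

Definition planar (R : realType) (p : 'rV[R]_3) : 'rV[R]_2 :=
  vec2 (p 0 0) (p 0 1).

Definition cylpt (R : realType) (q : 'rV[R]_2) (theta : R) : 'rV[R]_3 :=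
  vec3 (q 0 0) (q 0 1) theta.

Definition cyl (R : realType) (A : set 'rV[R]_2) : set 'rV[R]_3 :=
  [set p | A (planar p)].

(** * Regularity *)

(* Class C^k on an open set U, for finite-dimensional V. *)
Fixpoint Ck (R : realType) (V W : normedModType R) (k : nat)
    (U : set V) (f : V -> W) : Prop :=
  match k with
  | 0 => forall x, U x -> {for x, continuous f}
  | k'.+1 => (forall x, U x -> differentiable f x) /\
             forall v : V, Ck k' U (fun x => 'D_v f x)
  end.

(* Class C^k on a set S that need not be open: on a neighbourhood of S. *)
Definition Ck_near (R : realType) (V W : normedModType R) (k : nat)
    (S : set V) (f : V -> W) : Prop :=
  exists U : set V, [/\ open U, S `<=` U & Ck k U f].

(* Real-analyticity in two variables: local expansion in an absolutely
   convergent double power series. *)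
Definition analytic_at (R : realType) (f : 'rV[R]_2 -> R) (p : 'rV[R]_2) : Prop :=
  exists (a : nat -> nat -> R) (r : R), 0 < r /\
    forall h k : R, `|h| < r -> `|k| < r ->
      cvgn (fun N : nat =>
        \sum_(i < N) \sum_(j < N) `|a i j * h ^+ i * k ^+ j|) /\
      (\sum_(i < N) \sum_(j < N) a i j * h ^+ i * k ^+ j) @[N --> \oo]
        --> f (p + vec2 h k).

(** * Solutions, invariant manifolds, transversality *)

(* u solves u' = f(u) on the open set of times J and stays in N there. *)
Definition solves (R : realType) (n : nat) (f : 'rV[R]_n.+1 -> 'rV[R]_n.+1)
    (N : set 'rV[R]_n.+1) (J : set R) (u : R^o -> 'rV[R]_n.+1) : Prop :=
  forall t : R^o, J t -> N (u t) /\ is_derive t (1 : R^o) u (f (u t)).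

(* Stable and unstable sets, relative to N, of {O} x S^1. Since theta ranges
   over the whole circle, the distance of p to {O} x S^1 is that of planar p
   to O. With N the phase space these are the global manifolds, with N a tubular
   neighbourhood of {O} x S^1 the local ones. *)
Definition Ws (R : realType) (f : 'rV[R]_3 -> 'rV[R]_3) (N : set 'rV[R]_3)
    (O : 'rV[R]_2) : set 'rV[R]_3 :=
  [set p | exists (u : R^o -> 'rV[R]_3) (d : R),
    [/\ 0 < d, solves f N [set t | - d < t] u, u 0 = p
      & planar (u t) @[t --> +oo] --> O]].

Definition Wu (R : realType) (f : 'rV[R]_3 -> 'rV[R]_3) (N : set 'rV[R]_3)
    (O : 'rV[R]_2) : set 'rV[R]_3 :=
  [set p | exists (u : R^o -> 'rV[R]_3) (d : R),
    [/\ 0 < d, solves f N [set t | t < d] u, u 0 = p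
      & planar (u t) @[t --> -oo] --> O]].

(* Velocities at p of the C^1 curves through p contained in W; for an invariant
   manifold W this is the tangent space at p. *)
Definition tangent (R : realType) (W : set 'rV[R]_3) (p : 'rV[R]_3) :
    set 'rV[R]_3 :=
  [set v | exists (gamma : R^o -> 'rV[R]_3) (d : R),
    [/\ 0 < d, Ck 1 [set s : R^o | `|s| < d] gamma, gamma 0 = p,
        (forall s : R, `|s| < d -> W (gamma s))
      & is_derive (0 : R^o) (1 : R^o) gamma v]].

(* p is a point of transverse intersection of W and W': the tangent spaces of W
   and W' at p together span R^3. *)
Definition transverse_at (R : realType) (W W' : set 'rV[R]_3) (p : 'rV[R]_3) :
    Prop :=
  [/\ W p, W' p
    & exists A : 'M[R]_3, A \in unitmx /\
        forall i, (tangent W p `|` tangent W' p) (row i A)].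

(** * The family of vector fields *)

Record forced_family (R : realType) := ForcedFamily {
  dom : set 'rV[R]_2;                      (* the planar domain V *)
  g : 'rV[R]_2 -> 'rV[R]_2;                (* (g_1, g_2) *)
  P : 'rV[R]_3 -> 'rV[R]_2;                (* (P_1, P_2) *)
  Q : 'rV[R]_3 -> 'rV[R]_2;                (* (Q_1, Q_2) *)
  omega : R;
  T : R;                                   (* length of the circle S^1 *)
  O1 : 'rV[R]_2;
  O2 : 'rV[R]_2;
  c1 : R; e1 : R; c2 : R; e2 : R;
  l1 : R^o -> 'rV[R]_2;                    (* heteroclinic from O1 to O2 *)
  l2 : R^o -> 'rV[R]_2;                    (* heteroclinic from O2 to O1 *)
  regionA : set 'rV[R]_2;
  Vstar : set 'rV[R]_2
}.

Definition space (R : realType) (F : forced_family R) : set 'rV[R]_3 :=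
  cyl (dom F).

(* The vector field f_mu on V x S^1. *)
Definition vf (R : realType) (F : forced_family R) (mu : R * R)
    (p : 'rV[R]_3) : 'rV[R]_3 :=
  cylpt (g F (planar p) + mu.1 *: P F p + mu.2 *: Q F p) (omega F).

Definition WuC1 (R : realType) (F : forced_family R) (mu : R * R) :=
  Wu (vf F mu) (space F) (O1 F).
Definition WsC1 (R : realType) (F : forced_family R) (mu : R * R) :=
  Ws (vf F mu) (space F) (O1 F).
Definition WuC2 (R : realType) (F : forced_family R) (mu : R * R) :=
  Wu (vf F mu) (space F) (O2 F).
Definition WsC2 (R : realType) (F : forced_family R) (mu : R * R) :=
  Ws (vf F mu) (space F) (O2 F).

(* The first return map to Out(C_1) is said to exhibit a heteroclinic tangle when
   the flow has this property; the map itself does not enter. *)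
Definition heteroclinic_tangle (R : realType) (F : forced_family R)
    (mu : R * R) : Prop :=
  exists p, transverse_at (WuC2 F mu) (WsC1 F mu) p.

Definition param_square (R : realType) (eps : R) : set (R * R) :=
  [set mu | 0 <= mu.1 <= eps /\ 0 <= mu.2 <= eps].

Definition pnorm (R : realType) (mu : R * R) : R :=
  Num.sqrt (mu.1 ^+ 2 + mu.2 ^+ 2).

(* The library's [jacobian] acts on row vectors on the right; transposition does
   not change the eigenvalues. *)
Definition hyperbolic_saddle (R : realType) (V : set 'rV[R]_2)
    (g : 'rV[R]_2 -> 'rV[R]_2) (O : 'rV[R]_2) (c e : R) : Prop :=
  [/\ V O, g O = 0, 0 < c, 0 < e
    & eigenvalue (jacobian g O) (- c) /\ eigenvalue (jacobian g O) e].

(* The pair m = n = 0 is left out: the bound is meaningless there. *)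
Definition diophantine (R : realType) (c e : R) : Prop :=
  exists d d' : R, [/\ 0 < d, 0 < d'
    & forall m n : nat, (0 < m + n)%N ->
        d * ((m + n)%:R `^ (- d')) < `|m%:R * c - n%:R * e|].

Definition heteroclinic_solution (R : realType) (V : set 'rV[R]_2)
    (g : 'rV[R]_2 -> 'rV[R]_2) (O O' : 'rV[R]_2) (l : R^o -> 'rV[R]_2) : Prop :=
  [/\ solves g V setT l, l t @[t --> -oo] --> O & l t @[t --> +oo] --> O'].

Definition planar_cycle (R : realType) (F : forced_family R) : set 'rV[R]_2 :=
  [set O1 F; O2 F] `|` range (l1 F) `|` range (l2 F).

Definition vanishes_to_first_order (R : realType) (P : 'rV[R]_3 -> 'rV[R]_2)
    (O : 'rV[R]_2) : Prop :=
  forall theta : R,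
    [/\ P (cylpt O theta) = 0,
        'D_(vec3 1 0 0) P (cylpt O theta) = 0
      & 'D_(vec3 0 1 0) P (cylpt O theta) = 0].

(** * Local coordinates and cross sections *)

Definition tube (R : realType) (delta : R) : set 'rV[R]_3 :=
  [set z | `|z 0 0| < delta /\ `|z 0 1| < delta].

(* H is the inverse of the chart: H (x_1, x_2, theta) is the point of V x R with
   coordinates (x_1, x_2, theta). *)
Record coordinates (R : realType) (f : 'rV[R]_3 -> 'rV[R]_3)
    (V : set 'rV[R]_3) (T : R) (O : 'rV[R]_2) (delta : R)
    (H : 'rV[R]_3 -> 'rV[R]_3) : Prop := Coordinates {
  coord_dom : forall z, tube delta z -> V (H z);
  coord_C1 : Ck 1 (tube delta) H;
  coord_unit : forall z, tube delta z -> jacobian H z \in unitmx;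
  coord_inj : forall z z', tube delta z -> tube delta z' -> H z = H z' -> z = z';
  coord_circle : forall z, tube delta z -> H (z + vec3 0 0 T) = H z + vec3 0 0 T;
  coord_C : H @` [set z : 'rV[R]_3 | z 0 0 = 0 /\ z 0 1 = 0] = cyl [set O];
  coord_Ws : Ws f (H @` tube delta) O = H @` [set z : 'rV[R]_3 | tube delta z /\ z 0 1 = 0];
  coord_Wu : Wu f (H @` tube delta) O = H @` [set z : 'rV[R]_3 | tube delta z /\ z 0 0 = 0]
}.

(* A point of In is encoded by (x_2, theta) and lies at x_1 = eps0; a point of
   Out is encoded by (x_1, theta) and lies at x_2 = eps0. *)
Definition in_pt (R : realType) (eps0 : R) (z : 'rV[R]_2) : 'rV[R]_3 :=
  vec3 eps0 (z 0 0) (z 0 1).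

Definition out_pt (R : realType) (eps0 : R) (z : 'rV[R]_2) : 'rV[R]_3 :=
  vec3 (z 0 0) eps0 (z 0 1).

Definition strip (R : realType) (a b : R) : set 'rV[R]_2 :=
  [set z | a <= z 0 0 <= b].

(* In(C_1), In(C_2) and Out(C_2) *)
Definition sec (R : realType) (k : R) (mu : R * R) : set 'rV[R]_2 :=
  strip (- (pnorm mu / k)) (k * pnorm mu).

(* Out(C_1) *)
Definition half_sec (R : realType) (k : R) (mu : R * R) : set 'rV[R]_2 :=
  strip 0 (k * pnorm mu).

(* The coordinate x_(j+1) of the vector field does not vanish on the section. *)
Definition crossed_by (R : realType) (f : 'rV[R]_3 -> 'rV[R]_3)
    (H : 'rV[R]_3 -> 'rV[R]_3) (j : 'I_3) (S : set 'rV[R]_3) : Prop :=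
  forall z w : 'rV[R]_3, S z -> 'd H z w = f (H z) -> w 0 j != 0.

(* Seen in the coordinates src and dst of two sections D and E, the flow of f in
   V sends each point z of D to its first hit with E, namely m z; the angular
   coordinate of the image is determined modulo T. *)
Definition flow_induces (R : realType) (f : 'rV[R]_3 -> 'rV[R]_3)
    (V : set 'rV[R]_3) (T : R) (src dst : 'rV[R]_2 -> 'rV[R]_3)
    (D E : set 'rV[R]_2) (m : 'rV[R]_2 -> 'rV[R]_2) : Prop :=
  forall z, D z -> E (m z) /\
    exists (u : R^o -> 'rV[R]_3) (tau d : R) (n : int),
      [/\ 0 < tau /\ 0 < d,
          solves f V [set t | - d < t < tau + d] u,
          u 0 = src z,
          u tau = dst (m z + vec2 0 (n%:~R * T))
        & forall t : R, 0 < t < tau -> ~ (dst @` E) (u t)].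

(* C^3 embedding of the compact annulus D, second coordinate modulo T. *)
Definition C3_embedding (R : realType) (T : R) (D : set 'rV[R]_2)
    (m : 'rV[R]_2 -> 'rV[R]_2) : Prop :=
  [/\ Ck_near 3 D m,
      forall z, D z -> jacobian m z \in unitmx
    & forall (z z' : 'rV[R]_2) (n : int), D z -> D z' ->
        m z = m z' + vec2 0 (n%:~R * T) ->
        exists n' : int, z = z' + vec2 0 (n'%:~R * T)].

Definition angle_periodic (R : realType) (T : R) (phi : 'rV[R]_2 -> R) : Prop :=
  forall z, phi (z + vec2 0 T) = phi z.

(* (x, theta) |-> (b x + nu Phi, theta + xi + nu Psi) *)
Definition global_map (R : realType) (b xi nu : R) (Phi Psi : 'rV[R]_2 -> R)
    (z : 'rV[R]_2) : 'rV[R]_2 :=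
  vec2 (b * z 0 0 + nu * Phi z) (z 0 1 + xi + nu * Psi z).

Definition critical_pt (R : realType) (phi : 'rV[R]_2 -> R^o) (z : 'rV[R]_2) :
    Prop :=
  forall v : 'rV[R]_2, 'D_v phi z = 0.

Definition hessian (R : realType) (phi : 'rV[R]_2 -> R^o) (z : 'rV[R]_2) :
    'M[R]_2 :=
  \matrix_(i, j)
    'D_(delta_mx 0 i) (fun y => 'D_(delta_mx 0 j) phi y) z.

(* The unstable manifold of C_2 meets Out(C_2) in the circle x = 0, so zeros are
   those of theta |-> phi (0, theta). *)
Definition nondegenerate_zero (R : realType) (phi : 'rV[R]_2 -> R^o)
    (theta : R) : Prop :=
  phi (vec2 0 theta) = 0 /\ 'D_(vec2 0 1) phi (vec2 0 theta) != 0.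

Record P7a (R : realType) (F : forced_family R) (eps eps0 k2 k1' : R)
    (H1 H2 : R * R -> 'rV[R]_3 -> 'rV[R]_3)
    (b1 xi1 : R) (Phi1 Psi1 : 'rV[R]_2 -> R^o) : Prop := {
  P7a_b : b1 != 0;
  P7a_per : angle_periodic (T F) Phi1 /\ angle_periodic (T F) Psi1;
  P7a_Psi : Ck_near 1 (half_sec k1' (eps, eps)) Psi1;
  P7a_Phi : Ck_near 3 (half_sec k1' (eps, eps)) Phi1;
  P7a_pos : forall z, half_sec k1' (eps, eps) z -> 0 < Phi1 z;
  P7a_nonconstant : exists z z', [/\ half_sec k1' (eps, eps) z,
    half_sec k1' (eps, eps) z' & Phi1 z != Phi1 z'];
  P7a_finite_crit : finite_set [set z | [/\ half_sec k1' (eps, eps) z,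
    0 <= z 0 1 < T F & critical_pt Phi1 z]];
  P7a_nondegenerate : forall z, half_sec k1' (eps, eps) z ->
    critical_pt Phi1 z -> hessian Phi1 z \in unitmx;
  P7a_flow : forall mu, param_square eps mu ->
    flow_induces (vf F mu) (space F) (T F)
      (H1 mu \o out_pt eps0) (H2 mu \o in_pt eps0)
      (half_sec k1' mu) (sec k2 mu) (global_map b1 xi1 mu.1 Phi1 Psi1) /\
    C3_embedding (T F) (half_sec k1' mu) (global_map b1 xi1 mu.1 Phi1 Psi1)
}.

Record P7b (R : realType) (F : forced_family R) (eps eps0 k1 k2' : R)
    (H1 H2 : R * R -> 'rV[R]_3 -> 'rV[R]_3)
    (b2 xi2 : R) (Phi2 Psi2 : 'rV[R]_2 -> R^o) : Prop := {
  P7b_b : b2 != 0;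
  P7b_per : angle_periodic (T F) Phi2 /\ angle_periodic (T F) Psi2;
  P7b_Psi : Ck_near 1 (sec k2' (eps, eps)) Psi2;
  P7b_Phi : Ck_near 1 (sec k2' (eps, eps)) Phi2;
  P7b_zeros : exists theta theta' : R,
    [/\ 0 <= theta < T F, 0 <= theta' < T F, theta != theta',
        nondegenerate_zero Phi2 theta & nondegenerate_zero Phi2 theta'];
  P7b_flow : forall mu, param_square eps mu ->
    flow_induces (vf F mu) (space F) (T F)
      (H2 mu \o out_pt eps0) (H1 mu \o in_pt eps0)
      (sec k2' mu) (sec k1 mu) (global_map b2 xi2 mu.2 Phi2 Psi2) /\
    C3_embedding (T F) (sec k2' mu) (global_map b2 xi2 mu.2 Phi2 Psi2)
}.

(* The sections lie in the domains of the coordinates and are transverse to the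
   flow. *)
Record cross_sections (R : realType) (F : forced_family R)
    (eps eps0 delta k1 k2 k1' k2' : R)
    (H1 H2 : R * R -> 'rV[R]_3 -> 'rV[R]_3) : Prop := {
  cs_eps0 : 0 < eps0 < delta;
  cs_k : [/\ 0 < k1, 0 < k2, 0 < k1' & 0 < k2'];
  cs_coord : forall mu, param_square eps mu ->
    coordinates (vf F mu) (space F) (T F) (O1 F) delta (H1 mu) /\
    coordinates (vf F mu) (space F) (T F) (O2 F) delta (H2 mu);
  cs_tube : forall mu, param_square eps mu ->
    [/\ in_pt eps0 @` sec k1 mu `<=` tube delta,
        in_pt eps0 @` sec k2 mu `<=` tube delta,
        out_pt eps0 @` half_sec k1' mu `<=` tube delta
      & out_pt eps0 @` sec k2' mu `<=` tube delta];
  cs_crossed : forall mu, param_square eps mu ->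
    [/\ crossed_by (vf F mu) (H1 mu) 0 (in_pt eps0 @` sec k1 mu),
        crossed_by (vf F mu) (H2 mu) 0 (in_pt eps0 @` sec k2 mu),
        crossed_by (vf F mu) (H1 mu) 1 (out_pt eps0 @` half_sec k1' mu)
      & crossed_by (vf F mu) (H2 mu) 1 (out_pt eps0 @` sec k2' mu)]
}.

(** * The class X^4_Gamma(V) *)

Record in_X4 (R : realType) (eps : R) (F : forced_family R) : Prop := {
  X4_dom : open (dom F);
  X4_analytic : forall p, dom F p ->
    analytic_at (fun q => g F q 0 0) p /\ analytic_at (fun q => g F q 0 1) p;
  X4_neq : O1 F != O2 F;
  X4_saddle1 : hyperbolic_saddle (dom F) (g F) (O1 F) (c1 F) (e1 F);
  X4_saddle2 : hyperbolic_saddle (dom F) (g F) (O2 F) (c2 F) (e2 F);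
  X4_omega : 0 < omega F;
  X4_T : 0 < T F;
  X4_P : Ck 4 (space F) (P F);
  X4_Q : Ck 4 (space F) (Q F);
  X4_P1 : e1 F < c1 F /\ e2 F < c2 F;
  X4_P2 : diophantine (c1 F) (e1 F) /\ diophantine (c2 F) (e2 F);
  X4_P3_connections :
    heteroclinic_solution (dom F) (g F) (O1 F) (O2 F) (l1 F) /\
    heteroclinic_solution (dom F) (g F) (O2 F) (O1 F) (l2 F);
  X4_P3_region : [/\ open (regionA F), regionA F !=set0, connected (regionA F),
    bounded_set (regionA F)
    & closure (regionA F) `\` regionA F = planar_cycle F];
  X4_P3_basin : [/\ open (Vstar F), Vstar F !=set0, Vstar F `<=` regionA F
    & forall p, Vstar F p -> exists (u : R^o -> 'rV[R]_2) (d : R),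
        [/\ 0 < d, solves (g F) (dom F) [set t | - d < t] u, u 0 = p
          & cluster (u t @[t --> +oo]) = planar_cycle F]];
  X4_P4 : forall p, space F p ->
    P F (p + vec3 0 0 (T F)) = P F p /\ Q F (p + vec3 0 0 (T F)) = Q F p;
  X4_P5 : [/\ vanishes_to_first_order (P F) (O1 F),
    vanishes_to_first_order (P F) (O2 F),
    vanishes_to_first_order (Q F) (O1 F)
    & vanishes_to_first_order (Q F) (O2 F)];
  X4_P6a : forall mu, param_square eps mu -> 0 < mu.1 -> mu.2 = 0 ->
    [/\ WuC1 F mu `&` WsC2 F mu = set0,
        WuC1 F mu `&` cyl (Vstar F) !=set0
      & WuC2 F mu `&` cyl (Vstar F) = WsC1 F mu `&` cyl (Vstar F)];
  X4_P6b : forall mu, param_square eps mu -> 0 < mu.2 -> mu.1 = 0 ->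
    WuC1 F mu `&` cyl (Vstar F) = WsC2 F mu `&` cyl (Vstar F) /\
    exists p, transverse_at (WuC2 F mu) (WsC1 F mu) p;
  X4_P7 : exists (eps0 delta k1 k2 k1' k2' : R)
      (H1 H2 : R * R -> 'rV[R]_3 -> 'rV[R]_3)
      (b1 xi1 b2 xi2 : R) (Phi1 Psi1 Phi2 Psi2 : 'rV[R]_2 -> R^o),
    [/\ cross_sections F eps eps0 delta k1 k2 k1' k2' H1 H2,
        P7a F eps eps0 k2 k1' H1 H2 b1 xi1 Phi1 Psi1
      & P7b F eps eps0 k1 k2' H1 H2 b2 xi2 Phi2 Psi2]
}.

(** * Two-dimensional Lebesgue measure of parameter sets *)

Definition Leb2 (R : realType) :
    set (measurableTypeR R * measurableTypeR R) -> \bar R :=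
  (@lebesgue_measure R \x @lebesgue_measure R)%E.

(* Lebesgue measurability: equality with a Borel set up to a Leb2-null set. *)
Definition Leb2_measurable (R : realType) (A : set (R * R)) : Prop :=
  exists2 B : set (measurableTypeR R * measurableTypeR R), measurable B &
    (@Leb2 R).-negligible ((A `\` B) `|` (B `\` A)).

Definition Bset (R : realType) (eps r : R) : set (R * R) :=
  [set mu | param_square eps mu /\ mu.1 ^+ 2 + mu.2 ^+ 2 <= r ^+ 2].

Definition tangle_set (R : realType) (F : forced_family R) (r : R) :
    set (R * R) :=
  [set mu | param_square r mu /\ heteroclinic_tangle F mu].

(* Main.v *)
Require Import Defs.
From HB Require Import structures.
From mathcomp Require Import all_boot all_order all_algebra.
From mathcomp Require Import all_classical all_reals all_analysis.
From mathcomp Require Import lra.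

(** The circle [x_1 = 0] of Out(C_2) lies in the unstable manifold of C_2. The
    second global map sends it to the curve
    [theta |-> (mu_2 Phi_2(0, theta), theta + xi_2 + mu_2 Psi_2(0, theta))] of
    In(C_1), where the stable manifold of C_1 is [x_2 = 0]. As soon as
    [mu_2 > 0], a nondegenerate zero of [Phi_2(0, _)] is therefore a transverse
    heteroclinic point. Hence a tangle can only be absent on the Leb2-null axis
    [mu_2 = 0], and the quotient is constantly [1]. *)

Set Implicit Arguments.
Unset Strict Implicit.
Unset Printing Implicit Defensive.

Import Order.TTheory GRing.Theory Num.Theory.
Import numFieldNormedType.Exports.

Local Open Scope classical_set_scope.
Local Open Scope ring_scope.

(** * Calculus of C^1 maps *)

Section C1Maps.
Variable R : realType.

(** In finite dimension [f] is a finite sum of coordinate functions times fixed vectors. *)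
Lemma row_linear_continuous n (W : normedModType R) (f : 'rV[R]_n -> W) :
  linear f -> continuous f.
Proof.
move=> lf z.
have fE : f = (fun u => \sum_(j < n) u 0 j *: f 'e_j) :> ('rV[R]_n -> W).
  pose L : {linear 'rV[R]_n -> W} :=
    HB.pack f (GRing.isLinear.Build _ _ _ _ _ lf).
  apply/funext => u; rewrite -[f]/(L : _ -> _) [in LHS](row_sum_delta u).
  by rewrite linear_sum; apply: eq_bigr => j _; rewrite linearZ.
rewrite {1}fE /continuous_at.
apply: (cvg_big (@add_continuous W) (nbhs_filter z)) => j _.
apply: (continuous_comp (f := fun u : 'rV[R]_n => u 0 j)
  (g := fun a : R => a *: f 'e_j)); first exact: coord_continuous.
exact: scalel_continuous.
Qed.

Lemma affine_C1 (V W : normedModType R) (U : set V) (p : W) (f : V -> W) :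
  linear f -> continuous f -> Ck 1 U (fun z => p + f z).
Proof.
move=> lf cf; pose L : {linear V -> W} :=
  HB.pack f (GRing.isLinear.Build _ _ _ _ _ lf).
have dL x : differentiable f x by exact: (@linear_differentiable _ _ _ L).
have d x : differentiable (fun z => p + f z) x.
  by apply: (@differentiableD _ _ _ (cst p) f).
split=> // v x _.
rewrite (_ : (fun _ => _) = cst (f v)); first exact: cvg_cst.
apply/funext => y; rewrite deriveE//.
rewrite (@diffD _ _ _ (cst p) f)//= diff_cst.
by rewrite (@diff_lin _ _ _ L)// [LHS]add0r.
Qed.

Lemma derive_compE n (V W : normedModType R) (h : V -> 'rV[R]_n)
    (f : 'rV[R]_n -> W) (x v : V) :
  differentiable h x -> differentiable f (h x) ->
  'D_v (f \o h) x = \sum_(i < n) 'D_v h x 0 i *: 'D_('e_i) f (h x).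
Proof.
move=> dh df; rewrite deriveE; last exact: differentiable_comp.
rewrite diff_comp//= [in LHS](row_sum_delta ('d h x v)) linear_sum.
by apply: eq_bigr => i _; rewrite linearZ !deriveE.
Qed.

(** [Ck] speaks of one direction at a time. As the middle space has finite dimension, the chain rule
    writes each directional derivative of the composite as a finite sum of products of continuous
    functions. *)
Lemma comp_C1 n (V W : normedModType R) (U : set V) (D : set 'rV[R]_n)
    (h : V -> 'rV[R]_n) (f : 'rV[R]_n -> W) :
  open U -> Ck 1 U h -> Ck 1 D f -> (forall x, U x -> D (h x)) ->
  Ck 1 U (f \o h).
Proof.
move=> oU [dh ch] [df cf] UD; split.
  by move=> x Ux; apply: differentiable_comp; [exact: dh|exact/df/UD].
move=> v x Ux /=.
(* The chain rule is available only at points of [U]; openness of [U] makes it hold near [x], which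
   is enough for a limit. *)
have eqD : {near x, (fun y => \sum_(i < n) 'D_v h y 0 i *: 'D_('e_i) f (h y))
    =1 (fun y => 'D_v (f \o h) y)}.
  near=> y; rewrite /= derive_compE//; [apply: dh|apply/df/UD];
    by near: y; exact: open_nbhs_nbhs.
suff: 'D_v (f \o h) y @[y --> x] -->
    \sum_(i < n) 'D_v h x 0 i *: 'D_('e_i) f (h x).
  by rewrite -derive_compE//; [exact: dh|exact/df/UD].
apply: cvg_trans; first exact: (near_eq_cvg eqD).
apply: (cvg_big (@add_continuous W) (nbhs_filter x)) => i _.
 apply: cvgZ.
  apply: (@continuous_comp _ _ _ ('D_v h) (fun M : 'rV[R]_n => M 0 i)).
    exact: ch.
  exact: coord_continuous.
apply: (@continuous_comp _ _ _ h ('D_('e_i) f)); last exact/cf/UD.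
exact/differentiable_continuous/dh.
Unshelve. all: by end_near. Qed.

Lemma line_C1 n (U : set R^o) (p v : 'rV[R]_n) :
  Ck 1 U (fun s : R^o => p + s *: v).
Proof.
apply: (@affine_C1 _ _ U p (fun s : R^o => s *: v)).
  by move=> a s t; rewrite scalerDl scalerA.
exact: scalel_continuous.
Qed.

Lemma Ck_sub k (V W : normedModType R) (U U' : set V) (f : V -> W) :
  U' `<=` U -> Ck k U f -> Ck k U' f.
Proof.
move=> sU; elim: k f => [|k IH] f /=; first by move=> cf x /sU; exact: cf.
by move=> [df cf]; split=> [x /sU /df//|v]; exact: IH.
Qed.

Lemma Ck_leq k l (V W : normedModType R) (U : set V) (f : V -> W) :
  (k <= l)%N -> Ck l U f -> Ck k U f.
Proof.
elim: k l f => [|k IH] [|l] f //= kl [df cf].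
  by move=> x /df/differentiable_continuous.
by split=> // v; exact: (IH l).
Qed.

End C1Maps.

(** * Gluing and translating solutions; invariance of the unstable set *)

Section Gluing.
Variable R : realType.

(** Every difference quotient of the glued map at [x] is one of [u] or one of [w], and both families
    tend to [l]. *)
Lemma is_derive_glue (V : normedModType R) (u w : R^o -> V) (x : R^o) (l : V) :
  u x = w x -> is_derive x (1 : R^o) u l -> is_derive x (1 : R^o) w l ->
  is_derive x (1 : R^o) (fun t : R^o => if t <= x then u t else w t) l.
Proof.
move=> uw [cu du] [cw dw]; set v := fun t : R^o => _.
have lu : h^-1 *: ((u \o shift x) (h *: (1 : R^o)) - u x) @[h --> (0 : R)^'] --> l.
  by rewrite -du; exact: cu.
have lw : h^-1 *: ((w \o shift x) (h *: (1 : R^o)) - w x) @[h --> (0 : R)^'] --> l.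
  by rewrite -dw; exact: cw.
have lv : h^-1 *: ((v \o shift x) (h *: (1 : R^o)) - v x) @[h --> (0 : R)^'] --> l.
  move=> A nA; have /= Au := lu A nA; have /= Aw := lw A nA.
  rewrite /= !nbhs_simpl /= in Au Aw *.
  move: Au Aw; apply: filterS2 => h Au Aw; rewrite /v /= lexx.
  by case: ifP => _ //; rewrite uw.
by split; [apply/cvg_ex; exists l|exact: cvg_lim].
Qed.

Lemma is_derive_shift_time (V : normedModType R) (u : R^o -> V) (a t : R^o)
    (l : V) :
  is_derive (t + a) (1 : R^o) u l ->
  is_derive t (1 : R^o) (fun s : R^o => u (s + a)) l.
Proof.
have E : (fun h : R => h^-1 *: (((fun s : R^o => u (s + a)) \o shift t)
      (h *: (1 : R^o)) - u (t + a)))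
    = (fun h : R => h^-1 *: ((u \o shift (t + a)) (h *: (1 : R^o)) - u (t + a))).
  by apply/funext => h /=; rewrite addrA.
by case=> cu du; split; [rewrite /derivable E|rewrite /derive E].
Qed.

Lemma solves_sub n (f : 'rV[R]_n.+1 -> 'rV[R]_n.+1) (N N' : set 'rV[R]_n.+1)
    (J : set R) u : N `<=` N' -> solves f N J u -> solves f N' J u.
Proof. by move=> NN' su t /su[/NN']. Qed.

(** Serves to pass from the local manifold inside a chart to the global one; likewise for
    [Wu_sub]. *)
Lemma Ws_sub f N N' O : N `<=` N' -> @Ws R f N O `<=` Ws f N' O.
Proof.
by move=> NN' p [u [d [d0 su u0 ul]]]; exists u, d; split=> //; exact: solves_sub su.
Qed.

Lemma Wu_sub f N N' O : N `<=` N' -> @Wu R f N O `<=` Wu f N' O.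
Proof.
by move=> NN' p [u [d [d0 su u0 ul]]]; exists u, d; split=> //; exact: solves_sub su.
Qed.

(** The backward orbit of [u 0] is continued by [u] itself, which gives a backward orbit of
    [u tau]. *)
Lemma Wu_flow f N O (u : R^o -> 'rV[R]_3) (tau d : R) :
  0 < tau -> 0 < d -> solves f N [set t | - d < t < tau + d] u ->
  Wu f N O (u 0) -> Wu f N O (u tau).
Proof.
move=> tau0 d0 su [w [d' [d'0 sw w0 wl]]].
pose v (t : R^o) : 'rV[R]_3 := if t <= 0 then w t else u t.
have sv : solves f N [set t | t < tau + d] v.
  move=> t /= tlt; rewrite /v.
  case: (ltgtP t 0) => t0.
  - have [Nw dw] := sw t (lt_trans t0 d'0); split=> //.
    apply: near_eq_is_derive dw; near=> s.
    by rewrite ifT// ltW//; near: s; exact: lt_nbhsl.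
  - have [|Nu du] := su t; first by rewrite /= tlt andbT (lt_trans _ t0)// oppr_lt0.
    split=> //; apply: near_eq_is_derive du; near=> s.
    by rewrite ifF//; apply/negbTE; rewrite -ltNge; near: s; exact: lt_nbhsr.
  (* At the junction both solutions are differentiable, with the common velocity [f (u 0)]. *)
  - have [Nw dw] : _ := sw 0 d'0.
    have [|Nu du] := su 0; first by rewrite /= oppr_lt0 d0 addr_gt0.
    rewrite t0; split=> //; apply: is_derive_glue => //.
    by rewrite w0.
(* Time is shifted so that the glued solution passes through [u tau] at time [0]. *)
exists (fun t => v (t + tau)), d; split=> //.
- move=> t /= td; have [|Nv dv] := sv (t + tau); first by rewrite /= addrC ltrD2l.
  by split=> //; exact: is_derive_shift_time.
- by rewrite /v add0r leNgt tau0.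
- apply: (@cvg_comp _ _ _ (fun t : R => t + tau) (fun t => planar (v t)) _ -oo).
    exact: cvg_addrr_Ny.
  apply: cvg_trans wl; apply: near_eq_cvg; near=> t.
  by rewrite /v ifT//; near: t; exact: nbhs_ninfty_le.
Unshelve. all: by end_near. Qed.

(** Translation by [a] is a symmetry of the field, so it maps backward orbits to backward orbits;
    later [a] is a whole number of turns. *)
Lemma Wu_translate f N O (a : 'rV[R]_3) :
  (forall p, N p -> N (p + a)) -> (forall p, N p -> f (p + a) = f p) ->
  (forall p, planar (p + a) = planar p) ->
  forall p, Wu f N O p -> Wu f N O (p + a).
Proof.
move=> Na fa pa p [u [d [d0 su u0 ul]]]; exists (fun t => u t + a), d; split=> //.
- move=> t td; have [Nu du] := su t td; split; first exact: Na.
  by rewrite fa// -[X in is_derive _ _ _ X]addr0; exact: is_deriveD.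
- by rewrite u0.
- by under eq_fun do rewrite pa.
Qed.

End Gluing.

(** * Transversality read off in a chart *)

Section Crossing.
Variable R : realType.

Lemma derive_line n (p v : 'rV[R]_n) (x : R^o) :
  'D_(1 : R^o) (fun s : R^o => p + s *: v) x = v.
Proof.
apply: lim_near_cst => //; near=> h.
rewrite /= opprD addrACA subrr add0r -scalerBl addrK scalerA.
rewrite [h *: _]mulr1 mulVf ?scale1r//.
by near: h; exact: nbhs_dnbhs_neq.
Unshelve. all: by end_near. Qed.

(** Curves are easiest to draw in coordinates; the chart pushes their velocity forward by its
    Jacobian, acting on row vectors from the right. *)
Lemma tangent_curve (W : set 'rV[R]_3) (D : set 'rV[R]_3)
    (H : 'rV[R]_3 -> 'rV[R]_3) (h : R^o -> 'rV[R]_3) (d : R) :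
  0 < d -> Ck 1 [set s : R^o | `|s| < d] h -> Ck 1 D H ->
  (forall s : R, `|s| < d -> D (h s) /\ W (H (h s))) ->
  tangent W (H (h 0)) ('D_(1 : R^o) h 0 *m jacobian H (h 0)).
Proof.
move=> d0 hC HC DW; have s0 : `|0 : R| < d by rewrite normr0.
have oU : open [set s : R^o | `|s| < d].
  rewrite (_ : [set _ | _] = ball (0 : R^o) d); first exact: ball_open.
  by apply/seteqP; split=> s /=; rewrite -ball_normE /= sub0r normrN.
exists (H \o h), d; split; [exact: d0| |by []| |].
- by apply: (comp_C1 oU hC HC) => s /DW[].
- by move=> s /DW[].
- have dh : differentiable h 0 by apply: hC.1.
  have dH : differentiable H (h 0) by apply: HC.1; exact: (DW 0 s0).1.
  split; first exact/diff_derivable/differentiable_comp.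
  rewrite deriveE; last exact: differentiable_comp.
  by rewrite diff_comp//= -deriveE// -deriveE// deriveEjacobian.
Qed.

Lemma replace_row_unitmx n (k : 'I_n) (v : 'rV[R]_n) : v 0 k != 0 ->
  (\matrix_(i < n) if i == k then v else 'e_i) \in unitmx.
Proof.
move=> vk; rewrite -row_free_unit; apply/row_freeP.
(* Row [k] of the inverse comes from solving the expansion of [v] in the basis for ['e_k]. *)
exists (\matrix_(i < n) if i == k then (v 0 k)^-1 *: ('e_k - (v - v 0 k *: 'e_k))
                         else 'e_i).
set M := \matrix_(i < n) _; set N := \matrix_(i < n) _.
have NE : forall u : 'rV[R]_n, u *m N =
    u + u 0 k *: ((v 0 k)^-1 *: ('e_k - (v - v 0 k *: 'e_k)) - 'e_k).
  move=> u; rewrite mulmx_sum_row [X in _ = X + _](row_sum_delta u).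
  rewrite (bigD1 k)//= [in RHS](bigD1 k)//= /N rowK eqxx addrAC -scalerDr subrKC.
  by congr (_ + _); apply: eq_bigr => i ik; rewrite rowK (negbTE ik).
apply/row_matrixP => i; rewrite row_mul rowK NE row1.
case: eqP => [->|/eqP ik].
  rewrite scalerBr scalerA divff// scale1r.
  by rewrite opprB (addrCA 'e_k) addrAC subrr add0r subrKC.
by rewrite !mxE eqxx /= eq_sym (negbTE ik) scale0r addr0.
Qed.

(** In the chart the local stable manifold is the plane [x_2 = 0], which [h] crosses with nonzero
    [x_2]-velocity. The invertible Jacobian of [H] carries the resulting basis to the phase
    space. *)
Lemma transverse_crossing f V T O delta H (W : set 'rV[R]_3)
    (h : R^o -> 'rV[R]_3) :
  coordinates f V T O delta H -> Ck 1 setT h ->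
  (forall s, tube delta (h s) /\ W (H (h s))) ->
  h 0 0 1 = 0 -> 'D_(1 : R^o) h 0 0 1 != 0 ->
  transverse_at W (Ws f V O) (H (h 0)).
Proof.
move=> cH hC hW h01 dh; have [h0 Wh0] := hW 0.
have WsH z : tube delta z -> z 0 1 = 0 -> Ws f V O (H z).
  move=> tz z1; apply: (@Ws_sub _ f (H @` tube delta)).
    by move=> _ [y ty <-]; exact: (coord_dom cH).
  by rewrite (coord_Ws cH); exists z.
split; [exact: Wh0|exact: WsH|].
(* In the coordinates of [H], the rows are the two directions spanning the
   tangent plane of [x_2 = 0] and the velocity of [h] at the crossing. *)
exists ((\matrix_(i < 3) if i == 1 then 'D_(1 : R^o) h 0 else 'e_i) *m
  jacobian H (h 0)); split.
  rewrite unitmx_mul replace_row_unitmx// (coord_unit cH)//.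
move=> i; rewrite row_mul rowK; case: eqP => [_|/eqP i1]; [left|right].
  apply: (@tangent_curve _ (tube delta) H h 1) => //.
    exact: Ck_sub hC.
  exact: (coord_C1 cH).
(* For [i] other than [1] the straight line in direction ['e_i] stays in [x_2 = 0]; the radius
   [delta - |x_1|] keeps it in the tube. *)
have := @tangent_curve (Ws f V O) (tube delta) H (fun s => h 0 + s *: 'e_i)
  (delta - `|h 0 0 0|).
rewrite derive_line scale0r addr0; apply.
- by rewrite subr_gt0; case: h0.
- exact: line_C1.
- exact: (coord_C1 cH).
- move=> s sd; have ts : tube delta (h 0 + s *: 'e_i).
    split; rewrite !mxE /=.
      rewrite (le_lt_trans (ler_normD _ _))// -ltrBrDl.
      by case: (_ == i); rewrite ?mulr1// mulr0 normr0 subr_gt0; case: h0.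
    by rewrite eq_sym (negbTE i1) mulr0 addr0; case: h0.
  split=> //; apply: WsH => //.
  by rewrite !mxE eq_sym (negbTE i1) mulr0 addr0.
Qed.

End Crossing.

(** * Equivariance under whole turns of the angle *)

Section Angles.
Variable R : realType.

Lemma in_pt_C1 (eps0 : R) (U : set 'rV[R]_2) : Ck 1 U (in_pt eps0).
Proof.
have lin : linear (fun z : 'rV[R]_2 => vec3 0 (z 0 0) (z 0 1)).
  move=> a z z'; apply/rowP => i; rewrite !mxE.
  by case: i => [[|[|[|]]]] //= _; rewrite ?mulr0 ?addr0.
rewrite (_ : in_pt eps0 = fun z => vec3 eps0 0 0 + vec3 0 (z 0 0) (z 0 1)).
  by apply: affine_C1 => //; exact: row_linear_continuous.
apply/funext => z; apply/rowP => i; rewrite !mxE.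
by case: i => [[|[|[|]]]] //= _; rewrite ?add0r ?addr0.
Qed.

Lemma vec3_scale (n T : R) : vec3 0 0 (n * T) = n *: vec3 0 0 T.
Proof.
apply/rowP => i; rewrite !mxE.
by case: i => [[|[|[|]]]] //= _; rewrite ?mulr0.
Qed.

Lemma in_pt_angle (eps0 t : R) (z : 'rV[R]_2) :
  in_pt eps0 (z + vec2 0 t) = in_pt eps0 z + vec3 0 0 t.
Proof.
apply/rowP => i; rewrite !mxE.
by case: i => [[|[|[|]]]] //= _; rewrite ?addr0.
Qed.

Lemma planar_angle (p : 'rV[R]_3) (t : R) : planar (p + vec3 0 0 t) = planar p.
Proof.
by apply/rowP => i; rewrite !mxE; case: i => [[|[|]]] //= _; rewrite ?addr0.
Qed.

Lemma tube_angle (delta : R) (z : 'rV[R]_3) (t : R) :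
  tube delta z -> tube delta (z + vec3 0 0 t).
Proof. by rewrite /tube /= !mxE /= !addr0. Qed.

(* The flow determines the angle of a hit only modulo [T], so solutions must be
   translated by [n T] for an arbitrary integer [n]. *)
Lemma equivariant_int (n : int) (D : set 'rV[R]_3) (G : 'rV[R]_3 -> 'rV[R]_3)
    (a b : 'rV[R]_3) :
  (forall z t, D z -> D (z + t *: a)) ->
  (forall z, D z -> G (z + a) = G z + b) ->
  forall z, D z -> G (z + n%:~R *: a) = G z + n%:~R *: b.
Proof.
move=> Da Gab.
have nat_case (k : nat) z : D z -> G (z + k%:R *: a) = G z + k%:R *: b.
  move=> Dz; elim: k => [|k IH]; first by rewrite !scale0r !addr0.
  by rewrite -natr1 !scalerDl !scale1r !addrA Gab ?IH//; exact: Da.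
move=> z Dz; case: n => k; first exact: nat_case.
(* A negative multiple is undone by [k.+1] forward translations, to which the natural case
   applies. *)
rewrite NegzE mulrNz -pmulrn !scaleNr; apply: (addIr (k.+1%:R *: b)).
rewrite -nat_case ?subrK//.
by rewrite -scaleNr; exact: Da.
Qed.

Lemma vf_periodic eps (F : forced_family R) mu (n : int) p :
  in_X4 eps F -> Defs.space F p ->
  vf F mu (p + vec3 0 0 (n%:~R * T F)) = vf F mu p.
Proof.
move=> FX; rewrite vec3_scale.
(* Invariance is equivariance with increment [0]. *)
move: p; have := @equivariant_int n (Defs.space F) (vf F mu) (vec3 0 0 (T F)) 0.
rewrite scaler0 => E p Fp; rewrite E ?addr0// => z.
- by move=> t; rewrite -vec3_scale /Defs.space /cyl /= planar_angle.
- move=> Fz; rewrite /vf planar_angle addr0.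
  by have [-> ->] := X4_P4 FX Fz.
Qed.

Lemma coordinates_angle f V (T : R) O delta H (n : int) z :
  coordinates f V T O delta H -> tube delta z ->
  H (z + vec3 0 0 (n%:~R * T)) = H z + vec3 0 0 (n%:~R * T).
Proof.
move=> cH; rewrite !vec3_scale; apply: equivariant_int; last exact: coord_circle cH.
by move=> y t; rewrite -vec3_scale; exact: tube_angle.
Qed.

End Angles.

(** * Existence of a tangle off the axis [mu_2 = 0] *)

Section Tangle.
Variable R : realType.

Lemma sec_circle (k : R) mu (z : 'rV[R]_2) : 0 < k -> z 0 0 = 0 -> sec k mu z.
Proof.
move=> k0 z0; have n0 : 0 <= pnorm mu := sqrtr_ge0 _.
have k0' := ltW k0; rewrite /sec /strip /= z0 oppr_le0.
by rewrite divr_ge0 ?mulr_ge0.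
Qed.

Lemma in_X4_tangle (eps : R) (F : forced_family R) (mu : R * R) :
  0 < eps -> in_X4 eps F -> param_square eps mu -> 0 < mu.2 ->
  heteroclinic_tangle F mu.
Proof.
move=> eps0 FX Emu mu2.
have [e0 [delta [k1 [k2 [k1' [k2' [H1 [H2 [b1 [xi1 [b2 [xi2 [Phi1 [Psi1 [Phi2
  [Psi2 [cs _ p7]]]]]]]]]]]]]]]]] := X4_P7 FX.
have [theta [_ [_ _ _ [zero nondeg] _]]] := P7b_zeros p7.
have [flow [[U [oU sU CU]] _ _]] := P7b_flow p7 Emu.
have [C1 C2] := cs_coord cs Emu.
have [tin _ _ tout] := cs_tube cs Emu.
have [_ _ _ k2'0] := cs_k cs.
pose m := global_map b2 xi2 mu.2 Phi2 Psi2.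
(* The circle [x_1 = 0] of Out(C_2), lifted to the universal cover and started at a zero of
   [Phi2]. *)
pose line (s : R^o) := vec2 0 theta + s *: vec2 0 1.
have line0 s : line s 0 0 = 0 by rewrite !mxE /= mulr0 addr0.
have linesec s mu' : sec k2' mu' (line s) by exact: sec_circle.
pose h := in_pt e0 \o (m \o line).
have hC : Ck 1 setT h.
  apply: (@comp_C1 _ _ _ _ setT setT) => //; first exact: openT;
    last exact: in_pt_C1.
  apply: (@comp_C1 _ _ _ _ setT U) => //; first exact: openT.
  - exact: line_C1.
  - exact: Ck_leq CU.
  - by move=> s _; exact: sU.
have h_tube s : tube delta (h s).
  by apply: tin; exists (m (line s)) => //; exact: (flow _ (linesec s mu)).1.
(* On [x_1 = 0] the term [b2 * x_1] drops out of the global map. *)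
have hE s : h s 0 1 = mu.2 * Phi2 (line s).
  by rewrite mxE /= mxE /= line0 mulr0 add0r.
have lineE0 : line 0 = vec2 0 theta by rewrite /line scale0r addr0.
exists (H1 mu (h 0)); apply: (transverse_crossing C1 hC).
- move=> s; split=> //.
  (* The orbit leaves from the local unstable manifold of C_2, so its hit with In(C_1) lies in the
     global one. *)
  have [_ [u [tau [d [n [[tau0 d0] su u0 utau _]]]]]] := flow _ (linesec s mu).
  have Wutau : WuC2 F mu (u tau).
    apply: (Wu_flow tau0 d0 su); rewrite u0 /=.
    apply: (@Wu_sub _ _ (H2 mu @` tube delta)).
      by move=> _ [y ty <-]; exact: (coord_dom C2).
    rewrite (coord_Wu C2); exists (out_pt e0 (line s)) => //; split.
      by apply: tout; exists (line s).
    by rewrite mxE /= line0.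
  (* The actual hit differs from the point of the curve by [n] turns, which are translated back. *)
  have -> : H1 mu (h s) = u tau + vec3 0 0 ((- n)%:~R * T F).
    rewrite utau /= in_pt_angle (coordinates_angle n C1); last exact: h_tube.
    by rewrite mulrNz !vec3_scale scaleNr addrK.
  apply: Wu_translate Wutau => p.
  + by rewrite /Defs.space /cyl /= planar_angle.
  + by move=> Fp; exact: vf_periodic FX Fp.
  + exact: planar_angle.
- by rewrite hE lineE0 zero mulr0.
(* The [x_2]-velocity is [mu.2] times the angular derivative of [Phi2] at its nondegenerate zero. *)
- have dh : differentiable h 0 by exact: hC.1.
  rewrite derive_mx; last exact: diff_derivable.
  rewrite mxE (_ : (fun t => _) = (fun t => mu.2 * Phi2 (line t))); last first.
    exact/funext.
  have [U' [oU' sU' [dPhi _]]] := P7b_Phi p7.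
  have dP : derivable Phi2 (vec2 0 theta) (vec2 0 1).
    by apply/diff_derivable/dPhi/sU'; rewrite -lineE0.
  have lE : line = fun s => s *: vec2 0 1 + vec2 0 theta.
    by apply/funext => s; rewrite addrC.
  have dPl : derivable (Phi2 \o line) 0 1.
    by rewrite lE; have /derivable1P := dP.
  rewrite (deriveMl mu.2 dPl) mulf_neq0 ?(gt_eqF mu2)//.
  have -> : 'D_1 (Phi2 \o line) 0 = 'D_(vec2 0 1) Phi2 (vec2 0 theta).
    rewrite lE /derive.
    set g1 := fun t => t^-1 *: _; set g2 := fun t => t^-1 *: _.
    suff -> : g1 = g2 by [].
    by apply/funext => t; rewrite /g1 /g2 /= addr0 scale0r add0r [t%:A]mulr1.
  exact: nondeg.
Qed.

End Tangle.

(** * Measure of the parameter sets *)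

Section ParameterMeasure.
Variable R : realType.

(** Both sets arise from the same measurable punctured set by adding at most one null point. *)
Lemma lebesgue_measure_setD1 (S S' : set R) (x : R) :
  measurable (S' : set (measurableTypeR R)) -> S `\ x = S' `\ x ->
  @lebesgue_measure R S = @lebesgue_measure R S'.
Proof.
move=> mS' SS'.
have D1 (C : set R) : measurable (C `\ x : set (measurableTypeR R)) ->
    @lebesgue_measure R C = @lebesgue_measure R (C `\ x).
  move=> mC; have [Cx|Cx] := pselect (C x); last by rewrite not_setD1.
  rewrite -[in LHS](setD1K Cx) measureU//.
  - rewrite [X in (X + _)%E](_ : _ = 0%E) ?add0e//.
    exact: lebesgue_measure_set1.
  - by apply/seteqP; split=> y //= -[->] [].
have mD : measurable (S' `\ x : set (measurableTypeR R)) by exact: measurableD.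
by rewrite (D1 S) ?SS'// (D1 S').
Qed.

(* [A] need not be measurable: on all sets, [\x] integrates the measures of the
   sections, and those of [A] and [B] differ at most by [0]. *)
Lemma Leb2_off_axis (A B : set (R * R)) :
  measurable (B : set (measurableTypeR R * measurableTypeR R)) ->
  (forall mu, mu.2 != 0 -> A mu <-> B mu) -> Leb2 A = Leb2 B.
Proof.
move=> mB AB; apply: eq_integral => x _ /=.
apply: (@lebesgue_measure_setD1 _ _ 0); first exact: measurable_xsection.
apply/seteqP; split=> y /= [/xsectionP Hy /eqP y0]; split; try exact/eqP;
  by apply/xsectionP; move: Hy; apply AB.
Qed.

Lemma Leb2_rect (a b : R) : 0 <= a -> 0 <= b ->
  Leb2 (`[0, a] `*` `[0, b])%classic = (a * b)%:E.
Proof.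
move=> a0 b0; rewrite /Leb2 product_measure1E//=.
have itv c : 0 <= c -> @lebesgue_measure R `[0, c]%classic = c%:E.
  rewrite le_eqVlt lebesgue_measure_itv /= lte_fin.
  by move=> /predU1P[<-|->]; rewrite ?ltxx ?sube0.
by rewrite EFinM -(itv _ a0) -(itv _ b0).
Qed.

Lemma measurable_Bset (eps r : R) :
  measurable (Bset eps r : set (measurableTypeR R * measurableTypeR R)).
Proof.
have -> : Bset eps r = (`[0, eps] `*` `[0, eps])%classic `&`
    ((fun mu => mu.1 ^+ 2 + mu.2 ^+ 2) @^-1` `]-oo, r ^+ 2]%classic).
  apply/seteqP; split=> -[a b]; rewrite /Bset /param_square /= !in_itv /=;
    by move=> [[-> ->] ->].
apply: measurableI; first exact: measurableX.
rewrite -[X in measurable X]setTI.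
have : measurable_fun setT (fun mu : measurableTypeR R * measurableTypeR R =>
    (mu.1 : R) ^+ 2 + (mu.2 : R) ^+ 2 : measurableTypeR R).
  apply: measurable_realfun.measurable_funD;
    apply: measurable_realfun.measurable_funX.
    exact: measurable_fst.
  exact: measurable_snd.
by apply => //; exact: measurable_itv.
Qed.

(** As [fine] sends infinity to [0], the measure must be bounded on both sides: the square of side
    [r / 2] lies inside, since [2 * (r / 2) ^+ 2 <= r ^+ 2], and the square of side [eps] contains
    the set. *)
Lemma Bset_fine_gt0 (eps r : R) : 0 < r <= eps -> 0 < fine (Leb2 (Bset eps r)).
Proof.
move=> /andP[r0 reps]; have mB := measurable_Bset eps r.
have mI (a : R) : measurable ((`[0, a] `*` `[0, a])%classic
    : set (measurableTypeR R * measurableTypeR R)) by exact: measurableX.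
have h0 : 0 < r / 2 by rewrite divr_gt0.
rewrite fine_gt0//; apply/andP; split.
  apply: (@lt_le_trans _ _ (Leb2 (`[0, r / 2] `*` `[0, r / 2])%classic)).
    by rewrite Leb2_rect ?ltW// lte_fin mulr_gt0.
  apply: le_measure; rewrite ?inE//.
  move=> [a b] [/=]; rewrite !in_itv /= => /andP[a0 ar] /andP[b0 br].
  have rr : r / 2 <= eps.
    by rewrite (le_trans _ reps)// ler_pdivrMr// ler_peMr ?ltW// ltr1n.
  split; first by rewrite /param_square /= a0 b0 (le_trans ar) ?(le_trans br).
  have /= : a ^+ 2 + b ^+ 2 <= (r / 2) ^+ 2 + (r / 2) ^+ 2.
    by rewrite lerD// lerXn2r// nnegrE ltW.
  by move=> /le_trans; apply; have := sqr_ge0 r; rewrite expr_div_n; lra.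
apply: (@le_lt_trans _ _ (Leb2 (`[0, eps] `*` `[0, eps])%classic)).
  apply: le_measure; rewrite ?inE// => -[a b] [[/= ? ?] _].
  by split; rewrite /= in_itv.
by rewrite Leb2_rect ?ltry//; exact: le_trans (ltW r0) reps.
Qed.

End ParameterMeasure.

(* The first conjunct makes explicit that the measured sets are Lebesgue
   measurable, so that the quotient in the second one is meaningful. *)
Theorem mainTheorem7 (R : realType) (eps : R) (F : forced_family R)
    (eps_gt0 : 0 < eps) (FX : in_X4 eps F) :
  (forall r : R, 0 < r <= eps ->
     Leb2_measurable (tangle_set F r `&` Bset eps r)) /\
  fine (Leb2 (tangle_set F r `&` Bset eps r)) / fine (Leb2 (Bset eps r))
    @[r --> (0 : R)^'+] --> (1 : R).
Proof.
have off_axis r : 0 < r <= eps -> forall mu, mu.2 != 0 ->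
    (tangle_set F r `&` Bset eps r) mu <-> Bset eps r mu.
  move=> /andP[r0 reps] mu mu2; split=> [[]//|Bmu]; split=> //.
  have [[/andP[a0 ae] /andP[b0 be]] nmu] := Bmu; split.
    have bound (x : R) : 0 <= x -> x ^+ 2 <= r ^+ 2 -> x <= r.
      by move=> x0; rewrite ler_sqr// nnegrE ltW.
    split; apply/andP; split=> //; apply: bound => //; apply: le_trans nmu.
      by rewrite lerDl sqr_ge0.
    by rewrite lerDr sqr_ge0.
  apply: (in_X4_tangle eps_gt0 FX); first exact: Bmu.1.
  by rewrite lt_neqAle eq_sym mu2.
split=> [r reps|].
  exists (Bset eps r); first exact: measurable_Bset.
  (* The axis [mu_2 = 0] contains the symmetric difference; its measure is a product with factor
     [0], hence [0] even if the other factor is infinite. *)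
  exists (setT `*` [set 0]); split.
  - exact: measurableX.
  - by rewrite /Leb2 product_measure1E//= lebesgue_measure_set1 mule0.
  - by move=> mu /= mu_diff; split=> //=; apply: contrapT => /eqP mu2;
      move: mu_diff; have := off_axis r reps mu mu2; tauto.
(* Once [r <= eps], numerator and denominator are equal and nonzero. *)
apply: cvg_near_cst; near=> r.
have reps : 0 < r <= eps.
  by apply/andP; split; near: r; [exact: nbhs_right_gt|exact: nbhs_right_le].
rewrite (Leb2_off_axis (measurable_Bset eps r) (off_axis r reps)) divff//.
by rewrite gt_eqF// Bset_fine_gt0.
Unshelve. all: by end_near. Qed.
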